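(* Let $G$ be a simple graph and let $e=\{u,v\}$ be an edge of $G$. If the vertices $u$ and $v$ are adjacent to support vertices of $G$ (that is, $u$ is adjacent to a support vertex $w$ and $v$ is adjacent to a support vertex $z$), then $e$ is an irrelevant edge of $G$, i.e. $D_t(G,x)=D_t(G\setminus e,x)$.
   Context: A leaf is a vertex of degree one; a support vertex is a vertex adjacent to a leaf. For a simple graph $G=(V,E)$, a set $D\subseteq V$ is a total dominating set if every vertex of $V$ is adjacent to some vertex of $D$. $d_t(G,i)$ is the number of total dominating sets of $G$ of cardinality $i$, and $D_t(G,x)=\sum_i d_t(G,i)x^i$ is the total domination polynomial of $G$. $G\setminus e$ denotes $G$ with the edge $e$ deleted (vertices kept). An edge $e$ of $G$ is called irrelevant if $D_t(G,x)=D_t(G\setminus e,x)$.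
   Formalization: The support vertices w and z are additionally required to satisfy w ≠ v and z ≠ u; without this the claim fails, e.g. for the path a-u-v-b with w = v and z = u; G is taken to be finite. *)

(* Defs.v *)
From HB Require Import structures.
From mathcomp Require Import all_boot all_order all_algebra.

Set Implicit Arguments.
Unset Strict Implicit.
Unset Printing Implicit Defensive.

Import GRing.Theory.
Local Open Scope ring_scope.

Record sgraph := SGraph {
  vertex :> finType;
  adj : rel vertex;
  adj_sym : symmetric adj;
  adj_irrefl : irreflexive adj }.

Definition edges (G : sgraph) : {set {set G}} :=
  [set [set p.1; p.2] | p in [set p : G * G | adj p.1 p.2]].

Section DeleteEdge.
Variables (G : sgraph) (e : {set G}).

Definition del_adj : rel G :=
  fun x y => adj x y && ([set x; y] != e).

Lemma del_adj_sym : symmetric del_adj.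
Proof. by move=> x y; rewrite /del_adj adj_sym setUC. Qed.

Lemma del_adj_irrefl : irreflexive del_adj.
Proof. by move=> x; rewrite /del_adj adj_irrefl. Qed.

Definition del_edge : sgraph := SGraph del_adj_sym del_adj_irrefl.

End DeleteEdge.

Definition degree (G : sgraph) (x : G) : nat := #|[set y : G | adj x y]|.

Definition leaf (G : sgraph) (x : G) : bool := degree x == 1%N.

Definition support_vertex (G : sgraph) (x : G) : bool :=
  [exists y : G, adj x y && leaf y].

Definition total_dominating (G : sgraph) (D : {set G}) : bool :=
  [forall x : G, exists y in D, adj x y].

Definition num_tds (G : sgraph) (i : nat) : nat :=
  #|[set D : {set G} | total_dominating D && (#|D| == i)]|.

Definition total_dom_poly (G : sgraph) : {poly int} :=
  \sum_(i < #|G|.+1) (num_tds G i)%:R *: 'X^i.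

Definition irrelevant_edge (G : sgraph) (e : {set G}) : Prop :=
  e \in edges G /\ total_dom_poly G = total_dom_poly (del_edge e).

(* Main.v *)
Require Import Defs.
From mathcomp Require Import all_boot all_order all_algebra.

(** Every total dominating set contains every support vertex, since a leaf can
only be dominated by its unique neighbour. Hence, after the deletion of
[{u, v}], the vertices [u] and [v] remain dominated by [w] and [z], and no other
vertex loses a neighbour. *)

Lemma support_vertex_in_tds (G : sgraph) (D : {set G}) (w : G) :
  support_vertex w -> total_dominating D -> w \in D.
Proof.
move=> /existsP[y /andP[adj_wy /cards1P[t nbr_y]]] /forallP/(_ y).
move=> /existsP[s /andP[sD adj_ys]].
(* Both [w] and [s] are neighbours of the leaf [y], whose only neighbour is [t]. *)
have : w \in [set t] by rewrite -nbr_y inE adj_sym.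
have : s \in [set t] by rewrite -nbr_y inE.
by move=> /set1P <- /set1P ->.
Qed.

(** Adjacency after deletion implies adjacency in [G], so the same dominators work. *)
Lemma total_dominating_del_edgeW (G : sgraph) (e D : {set G}) :
  total_dominating (G := del_edge e) D -> total_dominating D.
Proof.
move=> /forallP domD; apply/forallP => x.
have /existsP[y /andP[yD /andP[adj_xy _]]] := domD x.
by apply/existsP; exists y; rewrite yD.
Qed.

Lemma pair_neq_edge (T : finType) (a b c : T) :
  c != a -> c != b -> [set c; a] != [set a; b] :> {set T}.
Proof.
move=> ca cb; apply/eqP => /setP/(_ c).
by rewrite !inE eqxx (negbTE ca) (negbTE cb).
Qed.

Lemma adj_neq (G : sgraph) (x y : G) : adj x y -> y != x.
Proof. by apply: contraTneq => ->; rewrite adj_irrefl. Qed.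

(** The conditions [w != v] and [z != u] ensure that the edges joining [u] to [w] and [v] to [z]
    survive the deletion. *)
Lemma total_dominating_del_edge (G : sgraph) (u v w z : G) (D : {set G}) :
    adj u w -> support_vertex w -> w != v ->
    adj v z -> support_vertex z -> z != u ->
  total_dominating (G := del_edge [set u; v]) D = total_dominating D.
Proof.
move=> uw suppw wv vz suppz zu; apply/idP/idP.
  exact: total_dominating_del_edgeW.
move=> domD.
have wD := support_vertex_in_tds _ _ _ suppw domD.
have zD := support_vertex_in_tds _ _ _ suppz domD.
apply/forallP => x; have [->|xu] := eqVneq x u.
  apply/existsP; exists w; rewrite wD /=.
  by apply/andP; split=> //; rewrite setUC pair_neq_edge // (adj_neq _ _ _ uw).
have [->|xv] := eqVneq x v.
  apply/existsP; exists z; rewrite zD /=.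
  apply/andP; split=> //; rewrite setUC (setUC [set u]).
  by rewrite pair_neq_edge // (adj_neq _ _ _ vz).
have /existsP[y /andP[yD adj_xy]] := forallP domD x.
apply/existsP; exists y; rewrite yD /=; apply/andP; split=> //.
(* [x] lies in [[set x; y]] but is neither [u] nor [v]. *)
apply/eqP => /setP/(_ x).
by rewrite !inE eqxx (negbTE xu) (negbTE xv).
Qed.

Theorem theorem2p6 (G : sgraph) (e : {set G}) (u v w z : G)
    (he : e \in edges G) (heuv : e = [set u; v])
    (huw : adj u w) (hw : support_vertex w) (hwv : w != v)
    (hvz : adj v z) (hz : support_vertex z) (hzu : z != u) :
  irrelevant_edge e.
Proof.
(* Deletion keeps the vertices, so both sums have the same range and the counted sets are compared
   one [D] at a time. *)
split=> //; subst e; apply: eq_bigr => i _.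
congr (_%:R *: _)%R; apply: eq_card => D.
rewrite !inE; congr andb; symmetry.
exact: (total_dominating_del_edge _ _ _ _ _ _ huw hw hwv hvz hz hzu).
Qed.
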